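(* Let $A$ and $B$ be unital rings. Assume that $A$ is additively spanned by Jordan products of its idempotents and that $\frac{1}{2}\in B$. If $T:A\to B$ is a surjective additive map such that for all $x,y\in A$, $$xy=yx=0 \implies T(x)\circ T(y)=0,$$ then $T$ is a weighted Jordan homomorphism.
   Context: Rings are associative. In any ring, $x\circ y=xy+yx$ denotes the Jordan product. A ring $A$ is additively spanned by Jordan products of its idempotents if $A$ equals its additive subgroup generated by the elements $e\circ f$ where $e,f\in A$ are idempotents. The condition $\frac12\in B$ means that $1+1$ is an invertible element of $B$. An additive map $\Phi:A\to B$ between unital rings is a Jordan homomorphism if $\Phi(x\circ y)=\Phi(x)\circ\Phi(y)$ for all $x,y\in A$. An additive map $T:A\to B$ is a weighted Jordan homomorphism if $c=T(1)$ is an invertible element lying in the center of $B$ and $x\mapsto c^{-1}T(x)$ is a Jordan homomorphism, that is, $cT(x\circ y)=T(x)\circ T(y)$ for all $x,y\in A$. *)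

(* Defs.v *)
From mathcomp Require Import all_boot all_algebra.

Set Implicit Arguments.
Unset Strict Implicit.
Unset Printing Implicit Defensive.

Import GRing.Theory.
Local Open Scope ring_scope.

(* Rings are [pzRingType]s, so that the zero ring is a unital ring. *)

Definition jordan (R : pzRingType) (x y : R) : R := x * y + y * x.

Definition is_idempotent (R : pzRingType) (e : R) : Prop := e * e = e.

Definition is_inverse (R : pzRingType) (a b : R) : Prop :=
  a * b = 1 /\ b * a = 1.

(* [GRing.unit] requires a decidable inverse on a nonzero ring. *)
Definition invertible (R : pzRingType) (a : R) : Prop :=
  exists b : R, is_inverse a b.

Definition central (R : pzRingType) (a : R) : Prop :=
  forall b : R, GRing.comm a b.

Inductive additive_span (V : zmodType) (S : V -> Prop) : V -> Prop :=
| additive_span_gen x : S x -> additive_span S x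
| additive_span0 : additive_span S 0
| additive_spanB x y :
    additive_span S x -> additive_span S y -> additive_span S (x - y).

Definition jordan_product_of_idempotents (R : pzRingType) (x : R) : Prop :=
  exists e f : R, [/\ is_idempotent e, is_idempotent f & x = jordan e f].

Definition spanned_by_jordan_products_of_idempotents (R : pzRingType) : Prop :=
  forall x : R, additive_span (@jordan_product_of_idempotents R) x.

Definition jordan_homomorphism (A B : pzRingType) (Phi : A -> B) : Prop :=
  zmod_morphism Phi /\
  forall x y : A, Phi (jordan x y) = jordan (Phi x) (Phi y).

(* [d] is the (unique) inverse of [T 1]. *)
Definition weighted_jordan_homomorphism (A B : pzRingType)
    (T : {additive A -> B}) : Prop :=
  central (T 1) /\
  exists d : B, is_inverse (T 1) d /\ jordan_homomorphism (fun x => d * T x).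

(* Main.v *)
Require Import Defs.
From mathcomp Require Import all_boot all_algebra.

Set Implicit Arguments.
Unset Strict Implicit.
Unset Printing Implicit Defensive.

Import GRing.Theory.
Local Open Scope ring_scope.

(** Put [c = T 1].  The proof separates the domain from the codomain.

    In the domain, consider the defect
    [D x y = 2 (T x o T y) - c o T (x o y)], where [o] is the Jordan product.
    It is symmetric and biadditive, vanishes when [x = 1], and vanishes when
    [x y = y x = 0].  These properties alone force [D = 0]
    ([orthogonal_form_eq0]).  Indeed, let [e] be an idempotent and [e' = 1 - e].
    Since [e] and [e'] are orthogonal, [D e e = D e 1 = 0].  For [n] in
    [e A e'] both [e + n] and [e - n] are idempotents, so [D x x] vanishes at
    [e], [e + n] and [e - n], which yields [D e n = 0].  As [e A e] and
    [e' A e'] are orthogonal, [D e] vanishes on every Peirce corner, hence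
    [D e = 0] ([of_idempotent]); applied to [e + n] this also gives [D n = 0].
    If [f] is a second idempotent, then [D f = 0], and the Peirce corners of
    [f] with respect to [e] other than [e f e] are killed when paired with
    [e A e]; hence [D (e f e) = 0] ([of_compression]), and finally
    [e o f = 2 e f e + e f e' + e' f e].

    In the codomain, [2 (T x o T y) = c o T (x o y)] and surjectivity of [T]
    show that the operator [b |-> c o b] is onto ([jordan_T1_surjective]).  An
    idempotent [e] satisfies [2 (T e)^2 = c o T e], from which [c^2] commutes
    with [T e]; hence it commutes with every [2 (T e o T f) = c o T (e o f)],
    that is, with all of [c o B = B].  An element with central square whose
    Jordan multiplication is onto is central and invertible
    ([central_sqr_jordan_surjective]), because
    [c o (c o b) = 2 c (c o b)] when [c^2] is central. *)

(** * Jordan products and Peirce corners *)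

Section JordanProduct.
Context {R : pzRingType}.
Implicit Types x y z e : R.

Lemma jordanC x y : jordan x y = jordan y x.
Proof. by rewrite /jordan addrC. Qed.

Lemma jordanBl x y z : jordan (x - y) z = jordan x z - jordan y z.
Proof. by rewrite /jordan mulrBl mulrBr addrACA opprD. Qed.

Lemma jordanBr x y z : jordan z (x - y) = jordan z x - jordan z y.
Proof. by rewrite !(jordanC z) jordanBl. Qed.

Lemma jordan1 x : jordan 1 x = x *+ 2.
Proof. by rewrite /jordan mul1r mulr1. Qed.

Lemma idempotent_compl e : is_idempotent e -> is_idempotent (1 - e).
Proof.
by move=> he; rewrite /is_idempotent mulrBr mulr1 mulrBl mul1r he subrr subr0.
Qed.

Lemma idempotent_mul_compl e : is_idempotent e -> e * (1 - e) = 0.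
Proof. by move=> he; rewrite mulrBr mulr1 he subrr. Qed.

Lemma idempotent_compl_mul e : is_idempotent e -> (1 - e) * e = 0.
Proof. by move=> he; rewrite mulrBl mul1r he subrr. Qed.

Lemma peirce_decomposition e x :
  x = e * x * e + e * x * (1 - e) + ((1 - e) * x * e + (1 - e) * x * (1 - e)).
Proof. by rewrite -!mulrDr !subrKC !mulr1 -mulrDl subrKC mul1r. Qed.

Lemma jordan_peirce e x :
  jordan e x = (e * x * e) *+ 2 + e * x * (1 - e) + (1 - e) * x * e.
Proof.
have hl : e * x = e * x * e + e * x * (1 - e).
  by rewrite -mulrDr subrKC mulr1.
have hr : x * e = e * x * e + (1 - e) * x * e.
  by rewrite -!mulrDl subrKC mul1r.
by rewrite /jordan {1}hl {1}hr addrACA -mulr2n addrA.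
Qed.

(** Adding an off-diagonal Peirce element is a square-zero conjugation of
    [e], which is why idempotents reach the off-diagonal corners. *)
Lemma idempotentD_corner e n :
  is_idempotent e -> e * n = n -> n * e = 0 -> is_idempotent (e + n).
Proof.
move=> he en ne; have nn : n * n = 0 by rewrite -{2}en mulrA ne mul0r.
by rewrite /is_idempotent mulrDl !mulrDr he en ne nn !addr0.
Qed.

End JordanProduct.

Lemma subrACA (V : zmodType) (p q r s : V) : p - q - (r - s) = p - r - (q - s).
Proof. by rewrite !opprB addrACA [RHS]addrACA (addrC (- q)). Qed.

(** * Forms vanishing on orthogonal pairs *)

(** The properties of the defect
    [D x y = 2 (T x o T y) - T 1 o T (x o y)] that the first half of the
    argument uses.  Once these hold, the multiplication of the codomain no
    longer matters, only that its additive group has no 2-torsion. *)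
Record orthogonal_form (A : pzRingType) (V : zmodType) (D : A -> A -> V) :
    Prop := OrthogonalForm {
  ofC : forall x y, D x y = D y x;
  ofBl : forall x y z, D (x - y) z = D x z - D y z;
  of1l : forall x, D 1 x = 0;
  of_orth : forall x y, x * y = 0 -> y * x = 0 -> D x y = 0
}.

Section OrthogonalForm.
Context {A : pzRingType} {V : zmodType} {D : A -> A -> V}.
Hypothesis hD : orthogonal_form D.
Hypothesis V_2torsion_free : forall v : V, v + v = 0 -> v = 0.
Implicit Types x y z e f n : A.

Lemma of0l x : D 0 x = 0.
Proof. by rewrite -(subrr (1 : A)) (ofBl hD) subrr. Qed.

Lemma ofNl x y : D (- x) y = - D x y.
Proof. by rewrite -[- x]sub0r (ofBl hD) of0l sub0r. Qed.

Lemma ofDl x y z : D (x + y) z = D x z + D y z.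
Proof. by rewrite -{1}(opprK y) (ofBl hD) ofNl opprK. Qed.

Lemma ofDr x y z : D x (y + z) = D x y + D x z.
Proof. by rewrite !(ofC hD x) ofDl. Qed.

Lemma ofNr x y : D x (- y) = - D x y.
Proof. by rewrite !(ofC hD x) ofNl. Qed.

(** Since [e] is orthogonal to [1 - e], [D e e] equals [D e 1]. *)
Lemma of_idempotent_sqr e : is_idempotent e -> D e e = 0.
Proof.
move=> he.
have := of_orth hD (idempotent_mul_compl he) (idempotent_compl_mul he).
by rewrite ofDr ofNr (ofC hD) (of1l hD) add0r => /eqP; rewrite oppr_eq0 => /eqP.
Qed.

(** Both [e + n] and [e - n] are idempotents; the quadratic form [D x x]
    vanishes on them, and subtracting gives [4 D e n = 0]. *)
Lemma of_idempotent_corner e n :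
  is_idempotent e -> e * n = n -> n * e = 0 -> D e n = 0.
Proof.
move=> he en ne.
have hp := of_idempotent_sqr (idempotentD_corner he en ne).
have hm : D (e - n) (e - n) = 0.
  by apply/of_idempotent_sqr/idempotentD_corner;
     rewrite ?mulrN ?mulNr ?en ?ne ?oppr0.
move: hp hm; rewrite !(ofDl, ofDr, ofNl, ofNr) opprK (of_idempotent_sqr he).
rewrite !add0r (ofC hD n e) => hp hm.
move: hm; rewrite addrA -opprD addrC => /subr0_eq hnn.
by apply/V_2torsion_free/V_2torsion_free; rewrite -{2}hnn -addrA.
Qed.

(** Because [D 1 = 0], the forms [D e] and [- D (1 - e)] agree, so each Peirce
    corner may be tested against whichever of [e] and [1 - e] is convenient:
    one of them is orthogonal to it, or fixes it on the left and kills it on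
    the right. *)
Lemma of_idempotent e x : is_idempotent e -> D e x = 0.
Proof.
move=> he; have he' := idempotent_compl he.
have eC y : D e y = - D (1 - e) y by rewrite (ofBl hD) (of1l hD) sub0r opprK.
rewrite (peirce_decomposition e x) !ofDr.
have ee' := idempotent_mul_compl he; have e'e := idempotent_compl_mul he.
rewrite [D e (e * x * e)]eC [D e ((1 - e) * x * e)]eC.
rewrite [D (1 - e) (e * x * e)](of_orth hD);
  rewrite ?[D e ((1 - e) * x * (1 - e))](of_orth hD);
  rewrite ?of_idempotent_corner ?oppr0 ?addr0 //;
  by rewrite ?mulrA ?he ?he' ?ee' ?e'e ?mul0r //
    -?mulrA ?he ?he' ?ee' ?e'e ?mulr0.
Qed.

(** An off-diagonal element is the difference of two idempotents. *)
Lemma of_corner e x y : is_idempotent e -> D (e * x * (1 - e)) y = 0.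
Proof.
move=> he; suff hg : is_idempotent (e + e * x * (1 - e)).
  by have := of_idempotent y hg; rewrite ofDl (of_idempotent y he) add0r.
apply: idempotentD_corner => //; first by rewrite !mulrA he.
by rewrite -mulrA idempotent_compl_mul ?mulr0.
Qed.

Lemma of_corner_compl e x y : is_idempotent e -> D ((1 - e) * x * e) y = 0.
Proof.
by move=> he; have := of_corner x y (idempotent_compl he); rewrite subKr.
Qed.

(** Although [e f e] need not be a combination of idempotents, paired with
    [e A e] it differs from the idempotent [f] only by corners on which [D]
    vanishes; the other corners of [A] are orthogonal to it or off-diagonal. *)
Lemma of_compression e f x :
  is_idempotent e -> is_idempotent f -> D (e * f * e) x = 0.
Proof.
move=> he hf; have ee' := idempotent_mul_compl he.
have e'e := idempotent_compl_mul he.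
have orth a b : D (e * a * e) ((1 - e) * b * (1 - e)) = 0.
  apply: (of_orth hD); rewrite !mulrA.
    by rewrite -(mulrA (e * a)) ee' mulr0 !mul0r.
  by rewrite -(mulrA ((1 - e) * b)) e'e mulr0 !mul0r.
have offdiag z a : D z (e * a * (1 - e)) = 0 by rewrite (ofC hD) of_corner.
have offdiag' z a : D z ((1 - e) * a * e) = 0.
  by rewrite (ofC hD) of_corner_compl.
rewrite (peirce_decomposition e x) !ofDr orth offdiag offdiag' !addr0.
have := of_idempotent (e * x * e) hf; rewrite {1}(peirce_decomposition e f).
by rewrite !ofDl of_corner // of_corner_compl // [D ((1 - e) * f * _) _](ofC hD)
  orth !addr0.
Qed.

Theorem orthogonal_form_eq0 x y :
  spanned_by_jordan_products_of_idempotents A -> D x y = 0.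
Proof.
move=> hA; elim: (hA x) => [_ [e [f [he hf ->]]]| |z t _ hz _ ht].
- rewrite jordan_peirce mulr2n !ofDl.
  by rewrite of_compression // of_corner // of_corner_compl // !addr0.
- exact: of0l.
- by rewrite (ofBl hD) hz ht subrr.
Qed.

End OrthogonalForm.

(** * Elements whose Jordan multiplication is onto *)

Section Codomain.
Context {B : pzRingType}.
Implicit Types b c t u : B.

Lemma invertible2_torsion_free u : invertible (1 + 1 : B) -> u + u = 0 -> u = 0.
Proof.
by case=> h [_ h2] hu; rewrite -[u]mul1r -h2 -mulrA mulrDl mul1r hu mulr0.
Qed.

(** Comparing [t] times the relation with the relation times [t] shows that
    [t^2] commutes with [c]; comparing the relation with [c] on both sides
    then gives the claim. *)
Lemma comm_sqr_of_jordan c t :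
  jordan c t = (t * t) *+ 2 -> GRing.comm (c * c) t.
Proof.
move=> ht; have htc : c * (t * t) = t * t * c.
  have /eqP : jordan c t * t = t * jordan c t.
    by rewrite ht mulrnAl mulrnAr mulrA.
  rewrite /jordan mulrDl mulrDr !mulrA addrC (inj_eq (addrI _)).
  by move=> /eqP.
have /eqP : c * jordan c t = jordan c t * c.
  by rewrite ht mulrnAl mulrnAr htc.
rewrite /jordan mulrDl mulrDr !mulrA [X in _ == X]addrC (inj_eq (addIr _)).
by move=> /eqP; rewrite -(mulrA t).
Qed.

(** If [u = c o b] and [c^2] is central then
    [c o u = 2 c^2 b + 2 c b c = 2 c u].  So [u c = c u] for every [u], and
    solving [c o u = 1] produces an inverse. *)
Lemma central_sqr_jordan_surjective c :
  central (c * c) -> (forall b, exists u, jordan c u = b) ->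
  central c /\ invertible c.
Proof.
move=> hcc surj.
have jordanE u : jordan c u = (c * u) *+ 2.
  have [b <-] := surj u.
  rewrite {1}/jordan mulr2n; congr (_ + _).
  by rewrite /jordan mulrDl mulrDr !mulrA -(mulrA b) -(hcc b) addrC.
have hc : central c.
  move=> u; have := jordanE u; rewrite /jordan mulr2n => /addrI.
  exact: esym.
split=> //; have [u hu] := surj 1.
exists (u *+ 2); rewrite /is_inverse mulrnAr mulrnAl -(hc u).
by rewrite -jordanE hu.
Qed.

End Codomain.

(** * The defect of an orthogonality preserving map *)

Section WeightedJordan.
Context {A B : pzRingType} (T : {additive A -> B}).
Hypothesis half : invertible (1 + 1 : B).

Definition jordan_defect (x y : A) : B :=
  (jordan (T x) (T y)) *+ 2 - jordan (T 1) (T (jordan x y)).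

Lemma orthogonal_form_jordan_defect :
  (forall x y, x * y = 0 -> y * x = 0 -> jordan (T x) (T y) = 0) ->
  orthogonal_form jordan_defect.
Proof.
move=> hT; split=> [x y|x y z|x|x y xy yx]; rewrite /jordan_defect.
- by rewrite (jordanC (T x)) (jordanC x).
- rewrite raddfB !jordanBl raddfB jordanBr mulrnBl.
  exact: subrACA.
- by rewrite jordan1 raddfMn /jordan mulrnAr mulrnAl -mulrnDl subrr.
- by rewrite hT // /jordan xy yx addr0 raddf0 mulr0 mul0r addr0 mul0rn subrr.
Qed.

Hypothesis jordanT : forall x y,
  jordan (T x) (T y) *+ 2 = jordan (T 1) (T (jordan x y)).
Hypothesis T_surj : forall b, exists a, T a = b.

(** With [T a = 1] the relation reads [4 T x = T 1 o T (a o x)], and [4] is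
    invertible. *)
Lemma jordan_T1_surjective b : exists u, jordan (T 1) u = b.
Proof.
have [h [h2 _]] := half; have [a ha] := T_surj 1.
have [x hx] := T_surj (h * (h * b)).
exists (T (jordan a x)); rewrite -jordanT ha jordan1 hx.
have twice u : (h * u) *+ 2 = u by rewrite -mulr_natl mulrA h2 mul1r.
by rewrite !twice.
Qed.

Lemma comm_sqr_T1_idempotent e :
  is_idempotent e -> GRing.comm (T 1 * T 1) (T e).
Proof.
move=> he; apply: comm_sqr_of_jordan; apply: subr0_eq.
apply: (invertible2_torsion_free half); rewrite -mulr2n mulrnBl.
have := jordanT e e; rewrite [jordan e e]/jordan he -mulr2n raddfMn.
have -> : jordan (T 1) (T e *+ 2) = jordan (T 1) (T e) *+ 2.
  by rewrite /jordan mulrnAr mulrnAl -mulrnDl.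
by move=> <-; rewrite {1}/jordan -mulr2n subrr.
Qed.

Hypothesis hA : spanned_by_jordan_products_of_idempotents A.

(** Every element of the codomain is [T 1 o T x], which for [x = e o f] is
    [2 (T e o T f)], a polynomial in images of idempotents. *)
Lemma central_sqr_T1 : central (T 1 * T 1).
Proof.
move=> b; have [u <-] := jordan_T1_surjective b; have [x <-] := T_surj u.
elim: (hA x) => [_ [e [f [he hf ->]]]| |y z _ hy _ hz].
- rewrite -jordanT; apply: commrMn; apply: commrD; apply: commrM;
    exact: comm_sqr_T1_idempotent.
- by rewrite raddf0 /jordan mulr0 mul0r addr0; apply: commr0.
- by rewrite raddfB jordanBr; apply: commrB.
Qed.

End WeightedJordan.

Theorem theorem2p3 (A B : pzRingType) (T : {additive A -> B})
    (hA : spanned_by_jordan_products_of_idempotents A)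
    (hB : invertible (1 + 1 : B))
    (T_surj : forall b : B, exists a : A, T a = b)
    (hT : forall x y : A, x * y = 0 -> y * x = 0 -> jordan (T x) (T y) = 0) :
  weighted_jordan_homomorphism T.
Proof.
have torsion_free (v : B) : v + v = 0 -> v = 0.
  exact: invertible2_torsion_free.
have jordanT x y : jordan (T x) (T y) *+ 2 = jordan (T 1) (T (jordan x y)).
  apply: subr0_eq.
  exact: (orthogonal_form_eq0 (orthogonal_form_jordan_defect hT) torsion_free).
have [hc [d hd]] := central_sqr_jordan_surjective
  (central_sqr_T1 hB jordanT T_surj hA) (jordan_T1_surjective hB jordanT T_surj).
have [cd dc] := hd.
have dC b : b * d = d * b.
  by rewrite -{1}[b]mul1r -{1}dc -!mulrA (mulrA (T 1)) (hc b) -mulrA cd mulr1.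
have TE x y : jordan (T x) (T y) = T 1 * T (jordan x y).
  apply: subr0_eq; apply: torsion_free; rewrite -mulr2n mulrnBl jordanT.
  by rewrite {1}/jordan -(hc (T _)) mulr2n subrr.
split=> //; exists d; split=> //; split=> [x y|x y].
  by rewrite raddfB mulrBr.
have dM u v : d * u * (d * v) = d * (d * (u * v)).
  by rewrite -!mulrA (mulrA u) dC -!mulrA.
rewrite {2}/jordan !dM -!mulrDr -/(jordan (T x) (T y)) TE.
by rewrite (mulrA d (T 1)) dc mul1r.
Qed.
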